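(* For all integers $m,n\ge1$, every function $\Psi:\mathbb{Z}^n\to\mathbb{R}_{>0}$ and each $\circ\in\{\ ,\ ',\ ''\}$, the set $\mathcal{F}^\circ_{n,m}(\Psi)=\bigcup_{k=1}^\infty\mathcal{A}^\circ_{n,m}(k\Psi)$ has Lebesgue measure $0$ or $1$.
   Context: Let $m,n\ge1$ be integers. Points $\mathbf{X}\in[0,1]^{nm}$ are regarded as real $n\times m$ matrices, $\mathbf{q}\in\mathbb{Z}^n$ as a row vector, so $\mathbf{q}\mathbf{X}\in\mathbb{R}^m$; $|\cdot|$ denotes the supremum norm on $\mathbb{R}^m$. For $\Psi:\mathbb{Z}^n\to\mathbb{R}_{>0}$ consider the inequality ( * ) $|\mathbf{q}\mathbf{X}+\mathbf{p}|<\Psi(\mathbf{q})$, with $\mathbf{p}=(p_1,\dots,p_m)\in\mathbb{Z}^m$, $\mathbf{q}\in\mathbb{Z}^n\setminus\{\mathbf{0}\}$. $\mathcal{A}_{n,m}(\Psi)$ is the set of $\mathbf{X}\in[0,1]^{nm}$ for which ( * ) holds for infinitely many pairs $(\mathbf{p},\mathbf{q})$; $\mathcal{A}'_{n,m}(\Psi)$ is the set of $\mathbf{X}\in[0,1]^{nm}$ for which ( * ) holds for infinitely many $(\mathbf{p},\mathbf{q})$ with $\gcd(\mathbf{p},\mathbf{q})=1$ (the gcd of all components of $\mathbf{p}$ and $\mathbf{q}$); $\mathcal{A}''_{n,m}(\Psi)$ is the set of $\mathbf{X}\in[0,1]^{nm}$ for which ( * ) holds for infinitely many $(\mathbf{p},\mathbf{q})$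 with $\gcd(p_j,\mathbf{q})=1$ for every $j=1,\dots,m$. $\mathcal{A}^\circ_{n,m}$ denotes any one of $\mathcal{A}_{n,m},\mathcal{A}'_{n,m},\mathcal{A}''_{n,m}$, and $k\Psi$ is the function $\mathbf{q}\mapsto k\Psi(\mathbf{q})$. *)

(* Defs.v *)
From Stdlib Require Import Reals ZArith List.
Import ListNotations.
Open Scope R_scope.

(* A point X in R^{nm} is an n x m real matrix, stored as X i j (only the
   entries i < n, j < m are relevant). *)
Definition Mat := nat -> nat -> R.

Fixpoint prodR (f : nat -> R) (N : nat) : R :=
  match N with
  | O => 1
  | S N' => prodR f N' * f N'
  end.

Definition in_cube (n m : nat) (X : Mat) : Prop :=
  forall i j, (i < n)%nat -> (j < m)%nat -> 0 <= X i j <= 1.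

Definition in_box (n m : nat) (a b : Mat) (X : Mat) : Prop :=
  forall i j, (i < n)%nat -> (j < m)%nat -> a i j <= X i j <= b i j.

Definition box_vol (n m : nat) (a b : Mat) : R :=
  prodR (fun i => prodR (fun j => b i j - a i j) m) n.

Definition lebesgue_null (n m : nat) (S : Mat -> Prop) : Prop :=
  forall eps, 0 < eps ->
  exists a b : nat -> Mat,
    (forall k i j, a k i j <= b k i j) /\
    (forall N, sum_f_R0 (fun k => box_vol n m (a k) (b k)) N <= eps) /\
    (forall X, S X -> exists k, in_box n m (a k) (b k) X).

Fixpoint sumR (f : nat -> R) (N : nat) : R :=
  match N with
  | O => 0
  | S N' => sumR f N' + f N'
  end.

Definition qX (n : nat) (q : list Z) (X : Mat) (j : nat) : R :=
  sumR (fun i => IZR (nth i q 0%Z) * X i j) n.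

(* Sup-norm inequality |qX + p| < psi, written coordinatewise. *)
Definition approx_ineq (n m : nat) (X : Mat) (p q : list Z) (psi : R) : Prop :=
  forall j, (j < m)%nat -> Rabs (qX n q X j + IZR (nth j p 0%Z)) < psi.

Inductive variant := Plain | Prime | DoublePrime.

Definition gcd_list (l : list Z) : Z := fold_right Z.gcd 0%Z l.

Definition coprime_cond (v : variant) (m : nat) (p q : list Z) : Prop :=
  match v with
  | Plain => True
  | Prime => gcd_list (p ++ q) = 1%Z
  | DoublePrime => forall j, (j < m)%nat -> gcd_list (nth j p 0%Z :: q) = 1%Z
  end.

(* A^o_{n,m}(Psi): X in [0,1]^{nm} such that the inequality holds for infinitely many
   pairs (p,q) (with the coprimality condition of the variant); "infinitely
   many" = not contained in any finite list. *)
Definition A_set (v : variant) (n m : nat) (Psi : list Z -> R) (X : Mat) : Prop :=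
  in_cube n m X /\
  forall L : list (list Z * list Z),
    exists p q : list Z,
      length p = m /\ length q = n /\ q <> repeat 0%Z n /\
      coprime_cond v m p q /\ approx_ineq n m X p q (Psi q) /\
      ~ In (p, q) L.

Definition F_set (v : variant) (n m : nat) (Psi : list Z -> R) (X : Mat) : Prop :=
  exists k : nat, (1 <= k)%nat /\ A_set v n m (fun q => INR k * Psi q) X.

(* Main.v *)
(** Split the infinitely many solutions according to the exact power of 2 dividing [q].
    If [2^a | q] and the entry [q_i / 2^a] is odd, then [X |-> 2 X + t], with [t] equal to
    [2^-a] on row [i] and zero elsewhere, maps solutions [(p, q)] to solutions
    [(2 p - q t, q)] at the price of doubling [k], and preserves all three coprimality
    conditions: [q t] is odd, and every odd common divisor of the entries of [q] divides
    [q t].  Blowing up a small dyadic cube around a density point shows that this part of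
    the set is null or of full measure.  If all these countably many parts are null, then
    for every [N] the set agrees, up to a null set, with the part on which
    [2^(N+1) | q]; that part is invariant under translation by [2^-N] times integer
    matrices, so that a high density in one dyadic cube is shared by all cubes of the same
    level. *)

Require Import Defs.
From Stdlib Require Import Reals ZArith Znumtheory List.
From Stdlib Require FinFun.
From Stdlib Require Import Lra Lia Cantor Classical IndefiniteDescription FunctionalExtensionality.
Import ListNotations.
Open Scope R_scope.

(** * Finite sums and products *)

Lemma prodR_ext f g N :
  (forall i, (i < N)%nat -> f i = g i) -> prodR f N = prodR g N.
Proof.
  induction N as [|N IH]; intros H; simpl; auto.
  rewrite (H N), IH; auto.
Qed.

Lemma prodR_nonneg f N :
  (forall i, (i < N)%nat -> 0 <= f i) -> 0 <= prodR f N.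
Proof.
  induction N as [|N IH]; intros H; simpl; [lra|].
  apply Rmult_le_pos; auto.
Qed.

Lemma prodR_le f g N :
  (forall i, (i < N)%nat -> 0 <= f i <= g i) -> prodR f N <= prodR g N.
Proof.
  induction N as [|N IH]; intros H; simpl; [lra|].
  apply Rmult_le_compat; try apply H; auto.
  apply prodR_nonneg; intros; apply H; auto.
Qed.

Lemma prodR_const c N : prodR (fun _ => c) N = c ^ N.
Proof. induction N as [|N IH]; simpl; auto. rewrite IH; ring. Qed.

Lemma prodR_scal c f N : prodR (fun i => c * f i) N = c ^ N * prodR f N.
Proof. induction N as [|N IH]; simpl; [ring|]. rewrite IH; ring. Qed.

Lemma prodR_zero f N i : (i < N)%nat -> f i = 0 -> prodR f N = 0.
Proof.
  induction N as [|N IH]; intros Hi Hf; simpl; [lia|].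
  destruct (Nat.eq_dec i N) as [->|]; [rewrite Hf; ring|].
  rewrite IH; [ring|lia|auto].
Qed.

(** A product is additive in each single factor; applied to rows and then to entries, this is what
    cutting a box by a hyperplane does to its volume. *)
Lemma prodR_split f g h N i0 :
  (i0 < N)%nat ->
  (forall i, (i < N)%nat -> i <> i0 -> f i = h i /\ g i = h i) ->
  f i0 + g i0 = h i0 -> prodR f N + prodR g N = prodR h N.
Proof.
  induction N as [|N IH]; intros Hi H H0; simpl; [lia|].
  destruct (Nat.eq_dec i0 N) as [->|Hne].
  - rewrite (prodR_ext f h), (prodR_ext g h), <- H0; [ring| |];
      intros; apply H; lia.
  - destruct (H N) as [-> ->]; [lia|lia|].
    rewrite <- IH; [ring|lia|intros; apply H; lia|auto].
Qed.

Lemma prodR_continuity (f : nat -> R -> R) N :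
  (forall i, continuity (f i)) -> continuity (fun x => prodR (fun i => f i x) N).
Proof.
  intros H; induction N as [|N IH]; simpl.
  - apply continuity_const; intros x y; reflexivity.
  - apply (continuity_mult (fun x => prodR (fun i => f i x) N) (f N)); auto.
Qed.

Definition lsum {A} (f : A -> R) (l : list A) : R :=
  fold_right (fun x s => f x + s) 0 l.

Lemma lsum_app {A} (f : A -> R) l1 l2 :
  lsum f (l1 ++ l2) = lsum f l1 + lsum f l2.
Proof. induction l1 as [|x l1 IH]; simpl; [ring|]. rewrite IH; ring. Qed.

Lemma lsum_nonneg {A} (f : A -> R) l : (forall x, 0 <= f x) -> 0 <= lsum f l.
Proof. intros H; induction l as [|x l IH]; simpl; [lra|]. specialize (H x); lra. Qed.

Lemma lsum_map {A B} (f : B -> R) (g : A -> B) l :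
  lsum f (map g l) = lsum (fun x => f (g x)) l.
Proof. induction l as [|x l IH]; simpl; auto. rewrite IH; auto. Qed.

Lemma lsum_incl {A} (f : A -> R) l1 : (forall x, 0 <= f x) ->
  forall l2, NoDup l1 -> incl l1 l2 -> lsum f l1 <= lsum f l2.
Proof.
  intros Hf; induction l1 as [|x l1 IH]; intros l2 Hnd Hi.
  - apply lsum_nonneg; auto.
  - inversion Hnd as [|? ? Hx Hnd']; subst.
    destruct (in_split x l2) as [u [v ->]]; [apply Hi; left; auto|].
    assert (lsum f l1 <= lsum f (u ++ v)).
    { apply IH; auto. intros y Hy.
      assert (Hy' : In y (u ++ x :: v)) by (apply Hi; right; auto).
      apply in_app_iff in Hy'. apply in_app_iff.
      destruct Hy' as [|[<-|]]; auto. contradiction. }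
    rewrite lsum_app in *; simpl; lra.
Qed.

Lemma sum_f_R0_lsum f N : sum_f_R0 f N = lsum f (seq 0 (S N)).
Proof.
  induction N as [|N IH]; [simpl; ring|].
  rewrite (seq_S (S N) 0), lsum_app, <- IH; simpl; ring.
Qed.

Lemma lsum_prod (f : nat * nat -> R) l1 l2 :
  lsum f (list_prod l1 l2) = lsum (fun x => lsum (fun y => f (x, y)) l2) l1.
Proof.
  induction l1 as [|x l1 IH]; simpl; auto.
  rewrite lsum_app, IH, lsum_map; auto.
Qed.

(** A Cantor code is at least the sum of the two numbers it encodes, so the codes up to [N] decode
    to distinct points of the square with both coordinates at most [N]. *)
Lemma sum_f_R0_of_nat (f : nat * nat -> R) N : (forall p, 0 <= f p) ->
  sum_f_R0 (fun k => f (of_nat k)) N <=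
  sum_f_R0 (fun k => sum_f_R0 (fun j => f (k, j)) N) N.
Proof.
  intros Hf.
  rewrite sum_f_R0_lsum, <- (lsum_map f of_nat).
  rewrite (sum_eq _ (fun k => lsum (fun j => f (k, j)) (seq 0 (S N))));
    [|intros; apply sum_f_R0_lsum].
  rewrite sum_f_R0_lsum, <- lsum_prod.
  apply lsum_incl; auto.
  - apply FinFun.Injective_map_NoDup; [|apply seq_NoDup].
    intros x y E; rewrite <- (cancel_to_of x), E; apply cancel_to_of.
  - intros [x y] H; apply in_map_iff in H; destruct H as [k [E Hk]].
    apply in_seq in Hk.
    pose proof (to_nat_non_decreasing x y) as Hd.
    rewrite <- E, cancel_to_of in Hd.
    apply in_prod; apply in_seq; lia.
Qed.

Lemma sum_nonneg_mono u N M : (forall k, 0 <= u k) -> (N <= M)%nat ->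
  sum_f_R0 u N <= sum_f_R0 u M.
Proof.
  intros Hu H; induction H as [|M H IH]; [lra|]. simpl; specialize (Hu (S M)); lra.
Qed.

(** Take for [c1] the supremum of the partial sums of [u]; comparing partial sums at the larger of
    two indices leaves [C - c1] for [v]. This distributes the cost of a cover over two covers. *)
Lemma sum_pair_split u v C :
  (forall k, 0 <= u k) -> (forall k, 0 <= v k) ->
  (forall N, sum_f_R0 u N + sum_f_R0 v N <= C) ->
  exists c1 c2, c1 + c2 <= C /\
    (forall N, sum_f_R0 u N <= c1) /\ (forall N, sum_f_R0 v N <= c2).
Proof.
  intros Hu Hv H.
  destruct (completeness (fun x => exists N, x = sum_f_R0 u N)) as [c1 [Hub Hl]].
  - exists C; intros x [N ->]. specialize (H N).
    assert (0 <= sum_f_R0 v N) by (apply cond_pos_sum; auto). lra.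
  - exists (sum_f_R0 u 0), 0%nat; auto.
  - exists c1, (C - c1); split; [lra|]; split.
    + intros N; apply Hub; exists N; auto.
    + intros N.
      assert (c1 <= C - sum_f_R0 v N); [|lra].
      apply Hl; intros x [M ->].
      pose proof (H (Nat.max M N)).
      pose proof (sum_nonneg_mono u M (Nat.max M N) Hu ltac:(lia)).
      pose proof (sum_nonneg_mono v N (Nat.max M N) Hv ltac:(lia)). lra.
Qed.

Lemma sum_half_pow eps N : 0 < eps ->
  sum_f_R0 (fun k => eps * (/2) ^ (S k)) N <= eps.
Proof.
  intros He.
  assert (E : sum_f_R0 (fun k => eps * (/2) ^ (S k)) N = eps - eps * (/2) ^ (S N)).
  { induction N as [|N IH]; [simpl; lra|]. rewrite tech5, IH. simpl; lra. }
  rewrite E. assert (0 < (/2) ^ S N) by (apply pow_lt; lra). nra.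
Qed.

(** * Outer measure *)

Section OuterMeasure.

Variables n m : nat.
Hypothesis Hn : (1 <= n)%nat.
Hypothesis Hm : (1 <= m)%nat.

Definition cov (S : Mat -> Prop) (c : R) : Prop :=
  exists a b : nat -> Mat,
    (forall k i j, a k i j <= b k i j) /\
    (forall N, sum_f_R0 (fun k => box_vol n m (a k) (b k)) N <= c) /\
    (forall X, S X -> exists k, in_box n m (a k) (b k) X).

(* [ole S c]: the outer Lebesgue measure of [S] is at most [c]. *)
Definition ole (S : Mat -> Prop) (c : R) : Prop :=
  forall eps, 0 < eps -> cov S (c + eps).

Lemma box_vol_nonneg (a b : Mat) : (forall i j, a i j <= b i j) -> 0 <= box_vol n m a b.
Proof.
  intros H; apply prodR_nonneg; intros; apply prodR_nonneg; intros.
  specialize (H i i0); lra.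
Qed.

Lemma box_vol_ext (a b a' b' : Mat) :
  (forall i j, (i < n)%nat -> (j < m)%nat -> b i j - a i j = b' i j - a' i j) ->
  box_vol n m a b = box_vol n m a' b'.
Proof.
  intros H; apply prodR_ext; intros; apply prodR_ext; intros; auto.
Qed.

Lemma box_vol_le (a b a' b' : Mat) :
  (forall i j, (i < n)%nat -> (j < m)%nat -> 0 <= b i j - a i j <= b' i j - a' i j) ->
  box_vol n m a b <= box_vol n m a' b'.
Proof.
  intros H; apply prodR_le; intros; split.
  - apply prodR_nonneg; intros; apply H; auto.
  - apply prodR_le; auto.
Qed.

Lemma box_vol_scal s (a b a' b' : Mat) :
  (forall i j, (i < n)%nat -> (j < m)%nat -> b' i j - a' i j = s * (b i j - a i j)) ->
  box_vol n m a' b' = s ^ (n * m) * box_vol n m a b.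
Proof.
  intros H; unfold box_vol.
  rewrite Nat.mul_comm, pow_mult, <- prodR_scal.
  apply prodR_ext; intros. rewrite <- prodR_scal. apply prodR_ext; auto.
Qed.

Lemma box_vol_point (a : Mat) : box_vol n m a a = 0.
Proof.
  apply (prodR_zero _ _ 0); [lia|].
  apply (prodR_zero _ _ 0); [lia|]. ring.
Qed.

Lemma null_ole S : lebesgue_null n m S <-> ole S 0.
Proof.
  split; intros H eps He; specialize (H eps He).
  - rewrite Rplus_0_l; exact H.
  - rewrite Rplus_0_l in H; exact H.
Qed.

Lemma ole_mono (S S' : Mat -> Prop) c c' :
  (forall X, S X -> S' X) -> c <= c' -> ole S' c -> ole S c'.
Proof.
  intros HS Hc H eps He. destruct (H eps He) as [a [b [H1 [H2 H3]]]].
  exists a, b; split; [auto|split; [|auto]].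
  intros N; specialize (H2 N); lra.
Qed.

Lemma ole_lim S c : (forall eps, 0 < eps -> ole S (c + eps)) -> ole S c.
Proof.
  intros H eps He. replace (c + eps) with (c + eps / 2 + eps / 2) by lra.
  apply H; lra.
Qed.

Lemma ole_nonneg S c : ole S c -> 0 <= c.
Proof.
  intros H. apply le_epsilon; intros eps He.
  destruct (H eps He) as [a [b [H1 [H2 _]]]].
  specialize (H2 0%nat); simpl in H2.
  pose proof (box_vol_nonneg (a 0%nat) (b 0%nat) (H1 0%nat)); lra.
Qed.

(** Cover the [k]-th set with error [eps / 2^(k+1)] and list all boxes along the Cantor pairing; the
    errors add up to at most [eps]. *)
Lemma ole_Union (S : nat -> Mat -> Prop) c C :
  (forall k, ole (S k) (c k)) -> (forall N, sum_f_R0 c N <= C) ->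
  ole (fun X => exists k, S k X) C.
Proof.
  intros HS HC eps He.
  destruct (functional_choice (fun k (ab : (nat -> Mat) * (nat -> Mat)) =>
    (forall l i j, fst ab l i j <= snd ab l i j) /\
    (forall N, sum_f_R0 (fun l => box_vol n m (fst ab l) (snd ab l)) N
       <= c k + eps * (/2) ^ (Datatypes.S k)) /\
    (forall X, S k X -> exists l, in_box n m (fst ab l) (snd ab l) X))) as [f Hf].
  { intros k. destruct (HS k (eps * (/2) ^ (Datatypes.S k))) as [a [b H]].
    - apply Rmult_lt_0_compat; [auto|apply pow_lt; lra].
    - exists (a, b); exact H. }
  exists (fun k => fst (f (fst (of_nat k))) (snd (of_nat k))),
         (fun k => snd (f (fst (of_nat k))) (snd (of_nat k))).
  split; [|split].
  - intros k i j; apply Hf.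
  - intros N.
    eapply Rle_trans.
    + apply (sum_f_R0_of_nat
        (fun p => box_vol n m (fst (f (fst p)) (snd p)) (snd (f (fst p)) (snd p)))).
      intros p; apply box_vol_nonneg; intros; apply Hf.
    + eapply Rle_trans.
      * apply sum_Rle; intros k _. simpl. apply (Hf k).
      * rewrite sum_plus. specialize (HC N). pose proof (sum_half_pow eps N He). lra.
  - intros X [k HX]. destruct (proj2 (proj2 (Hf k)) X HX) as [l Hl].
    exists (to_nat (k, l)). rewrite cancel_of_to; exact Hl.
Qed.

Lemma ole_empty (S : Mat -> Prop) : (forall X, ~ S X) -> ole S 0.
Proof.
  intros H eps He. exists (fun _ _ _ => 0), (fun _ _ _ => 0).
  split; [intros; lra|split].
  - intros N. rewrite (sum_eq _ (fun _ => 0)); [|intros; apply box_vol_point].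
    rewrite sum_cte; lra.
  - intros X HX; destruct (H X HX).
Qed.

Lemma ole_union2 (S1 S2 : Mat -> Prop) c1 c2 :
  ole S1 c1 -> ole S2 c2 -> ole (fun X => S1 X \/ S2 X) (c1 + c2).
Proof.
  intros H1 H2.
  pose proof (ole_nonneg _ _ H1). pose proof (ole_nonneg _ _ H2).
  apply ole_mono with
    (S' := fun X => exists k, match k with O => S1 | S O => S2 | _ => fun _ => False end X)
    (c := c1 + c2).
  - intros X [|]; [exists 0%nat|exists 1%nat]; auto.
  - lra.
  - apply ole_Union with (c := fun k => match k with O => c1 | S O => c2 | _ => 0 end).
    + intros [|[|k]]; auto. apply ole_empty; auto.
    + assert (E : forall N, sum_f_R0
        (fun k => match k with O => c1 | S O => c2 | _ => 0 end) (S N) = c1 + c2).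
      { induction N as [|N IH]; [reflexivity|]. rewrite tech5, IH; ring. }
      intros [|N]; [simpl; lra|rewrite E; lra].
Qed.

Lemma ole_Union_null (S : nat -> Mat -> Prop) :
  (forall k, ole (S k) 0) -> ole (fun X => exists k, S k X) 0.
Proof.
  intros H; apply ole_Union with (c := fun _ => 0); auto.
  intros N; rewrite sum_cte; lra.
Qed.

Lemma ole_box (a b : Mat) : (forall i j, a i j <= b i j) ->
  ole (in_box n m a b) (box_vol n m a b).
Proof.
  intros Hab eps He.
  (* All boxes after the first shrink to the point [a] and cost nothing. *)
  exists (fun _ => a), (fun k => match k with O => b | _ => a end).
  split; [|split].
  - intros [|k] i j; auto; lra.
  - intros N.
    assert (E : sum_f_R0 (fun k => box_vol n m a (match k with O => b | _ => a end)) N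
                = box_vol n m a b); [|lra].
    induction N as [|N IH]; [reflexivity|].
    rewrite tech5, IH, box_vol_point; ring.
  - intros X HX; exists 0%nat; exact HX.
Qed.

Lemma ole_affine (S S' : Mat -> Prop) c s (t : Mat) : 0 < s ->
  ole S c -> (forall X, S' X -> S (fun i j => (X i j - t i j) / s)) ->
  ole S' (s ^ (n * m) * c).
Proof.
  intros Hs H HS eps He.
  assert (Hp : 0 < s ^ (n * m)) by (apply pow_lt; auto).
  destruct (H (eps / s ^ (n * m))) as [a [b [H1 [H2 H3]]]].
  { apply Rdiv_lt_0_compat; auto. }
  exists (fun k i j => s * a k i j + t i j), (fun k i j => s * b k i j + t i j).
  split; [|split].
  - intros k i j; specialize (H1 k i j); nra.
  - intros N.
    rewrite (sum_eq _ (fun k => box_vol n m (a k) (b k) * s ^ (n * m))).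
    + rewrite <- scal_sum. specialize (H2 N).
      replace (s ^ (n * m) * c + eps) with (s ^ (n * m) * (c + eps / s ^ (n * m)))
        by (field; lra).
      apply Rmult_le_compat_l; lra.
    + intros k _. rewrite Rmult_comm. apply box_vol_scal; intros; ring.
  - intros X HX. destruct (H3 _ (HS X HX)) as [k Hk].
    exists k. intros i j Hi Hj. specialize (Hk i j Hi Hj); simpl in Hk.
    replace (X i j) with (s * ((X i j - t i j) / s) + t i j) by (field; lra).
    nra.
Qed.

(** The slack [eps] in [ole] makes the infimum of the admissible bounds admissible itself.
    [completeness] speaks of suprema, hence the negated bounds. *)
Lemma ole_inf S : (exists c, ole S c) ->
  exists c0, ole S c0 /\ forall c, ole S c -> c0 <= c.
Proof.
  intros [c Hc].
  destruct (completeness (fun x => ole S (- x))) as [l [Hub Hl]].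
  - exists 0; intros x Hx. apply ole_nonneg in Hx; lra.
  - exists (- c); rewrite Ropp_involutive; auto.
  - exists (- l); split.
    + apply ole_lim; intros eps He.
      destruct (classic (exists x, ole S (- x) /\ l - eps < x)) as [[x [Hx Hlt]]|Hno].
      * apply ole_mono with (S' := S) (c := - x); auto; lra.
      * exfalso. assert (l <= l - eps); [|lra].
        apply Hl; intros x Hx. apply Rnot_lt_le; intros Hlt.
        apply Hno; exists x; auto.
    + intros d Hd. assert (- d <= l); [|lra].
      apply Hub; rewrite Ropp_involutive; auto.
Qed.

(** * Carathéodory measurability *)

(** Carathéodory's criterion phrased through upper bounds, so that test sets of infinite outer
    measure impose nothing and no real-valued measure function is needed. *)
Definition meas (M : Mat -> Prop) : Prop :=
  forall A c, ole A c -> exists c1 c2, c1 + c2 <= c /\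
    ole (fun X => A X /\ M X) c1 /\ ole (fun X => A X /\ ~ M X) c2.

Lemma meas_eps M :
  (forall A c eps, 0 < eps -> ole A c -> exists c1 c2, c1 + c2 <= c + eps /\
    ole (fun X => A X /\ M X) c1 /\ ole (fun X => A X /\ ~ M X) c2) -> meas M.
Proof.
  intros H A c Hc.
  destruct (ole_inf (fun X => A X /\ M X)) as [c1 [H1 L1]].
  { exists c; apply ole_mono with (S' := A) (c := c); auto; tauto || lra. }
  destruct (ole_inf (fun X => A X /\ ~ M X)) as [c2 [H2 L2]].
  { exists c; apply ole_mono with (S' := A) (c := c); auto; tauto || lra. }
  exists c1, c2; split; auto.
  apply le_epsilon; intros eps He.
  destruct (H A c eps He Hc) as [d1 [d2 [Hd [Hd1 Hd2]]]].
  apply L1 in Hd1; apply L2 in Hd2; lra.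
Qed.

Lemma meas_ext M M' : (forall X, M X <-> M' X) -> meas M -> meas M'.
Proof.
  intros E H A c Hc. destruct (H A c Hc) as [c1 [c2 [Hle [H1 H2]]]].
  exists c1, c2; split; auto; split.
  - eapply ole_mono; [|apply Rle_refl|exact H1]. intros X; specialize (E X); tauto.
  - eapply ole_mono; [|apply Rle_refl|exact H2]. intros X; specialize (E X); tauto.
Qed.

Lemma meas_compl M : meas M -> meas (fun X => ~ M X).
Proof.
  intros H A c Hc. destruct (H A c Hc) as [c1 [c2 [Hle [H1 H2]]]].
  exists c2, c1; split; [lra|split; auto].
  eapply ole_mono; [|apply Rle_refl|exact H1].
  intros X [HA HM]; split; auto; apply NNPP; auto.
Qed.

Lemma meas_inter M1 M2 : meas M1 -> meas M2 -> meas (fun X => M1 X /\ M2 X).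
Proof.
  intros HM1 HM2 A c Hc.
  destruct (HM1 A c Hc) as [c1 [c2 [Hle [H1 H2]]]].
  destruct (HM2 _ _ H1) as [d1 [d2 [Hle' [H1' H2']]]].
  exists d1, (d2 + c2); split; [lra|split].
  - eapply ole_mono; [|apply Rle_refl|exact H1']. tauto.
  - eapply ole_mono; [|apply Rle_refl|exact (ole_union2 _ _ _ _ H2' H2)].
    intros X; simpl. destruct (classic (M1 X)); tauto.
Qed.

Lemma meas_const P : meas (fun _ => P).
Proof.
  intros A c Hc. pose proof (ole_nonneg _ _ Hc).
  destruct (classic P) as [HP|HP]; [exists c, 0|exists 0, c]; (split; [lra|split]).
  - apply ole_mono with (S' := A) (c := c); auto; tauto || lra.
  - apply ole_empty; tauto.
  - apply ole_empty; tauto.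
  - apply ole_mono with (S' := A) (c := c); auto; tauto || lra.
Qed.

(** [B k] is what is left of [A] outside the first [k] sets; [u k] and [r k] are the outer measures
    of [B k] inside [E k] and of [B k]. Measurability of [E k] gives [u k + r (k+1) <= r k];
    telescoping, the [u k] and the remainder [rho] together cost at most [c]. *)
Lemma meas_Union_nat (E : nat -> Mat -> Prop) :
  (forall k, meas (E k)) -> meas (fun X => exists k, E k X).
Proof.
  intros HE A c Hc.
  set (B := fun k X => A X /\ forall j, (j < k)%nat -> ~ E j X).
  assert (Hinf : forall S : Mat -> Prop, (forall X, S X -> A X) ->
    exists c0, ole S c0 /\ forall c, ole S c -> c0 <= c).
  { intros S HS; apply ole_inf; exists c.
    apply ole_mono with (S' := A) (c := c); auto; lra. }
  destruct (functional_choice (fun k c0 => ole (fun X => B k X /\ E k X) c0 /\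
    forall c, ole (fun X => B k X /\ E k X) c -> c0 <= c)) as [u Hu].
  { intros k; apply Hinf; unfold B; tauto. }
  destruct (functional_choice (fun k c0 => ole (B k) c0 /\
    forall c, ole (B k) c -> c0 <= c)) as [r Hr].
  { intros k; apply Hinf; unfold B; tauto. }
  destruct (Hinf (fun X => A X /\ ~ exists k, E k X)) as [rho [Hrho Lrho]].
  { tauto. }
  assert (Hstep : forall k, u k + r (S k) <= r k).
  { intros k. destruct (HE k (B k) (r k) (proj1 (Hr k))) as [c1 [c2 [Hle [H1 H2]]]].
    apply (proj2 (Hu k)) in H1.
    assert (r (S k) <= c2); [|lra].
    apply (proj2 (Hr (S k))).
    eapply ole_mono; [|apply Rle_refl|exact H2].
    intros X [HA Hj]; split; [split; auto|apply Hj; auto]. }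
  assert (Hrr : forall k, rho <= r k).
  { intros k. apply Lrho. eapply ole_mono; [|apply Rle_refl|exact (proj1 (Hr k))].
    intros X [HA Hj]; split; auto. intros j _ Hx; apply Hj; exists j; auto. }
  assert (Hr0 : r 0%nat <= c).
  { apply (proj2 (Hr 0%nat)). eapply ole_mono; [|apply Rle_refl|exact Hc].
    unfold B; tauto. }
  assert (Hsum : forall N, sum_f_R0 u N + r (S N) <= c).
  { induction N as [|N IH]; [simpl; specialize (Hstep 0%nat); lra|].
    rewrite tech5. specialize (Hstep (S N)); lra. }
  exists (c - rho), rho; split; [lra|split; auto].
  apply ole_mono with (S' := fun X => exists k, B k X /\ E k X) (c := c - rho); [|lra|].
  - intros X [HA [k Hk]].
    assert (Hmin : forall k, (forall j, (j < k)%nat -> ~ E j X) \/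
                        exists j, B j X /\ E j X).
    { induction k0 as [|l [IH|IH]]; [left; lia| |right; auto].
      destruct (classic (E l X)) as [Hl|Hl].
      - right; exists l; split; [split|]; auto.
      - left; intros j Hj. destruct (Nat.eq_dec j l) as [->|]; auto. apply IH; lia. }
    destruct (Hmin (S k)) as [H|H]; auto. exfalso; apply (H k); auto.
  - apply ole_Union with (c := u); [apply Hu|].
    intros N; specialize (Hsum N); specialize (Hrr (S N)); lra.
Qed.

Lemma meas_Union {I : Type} (e : nat -> I) (E : I -> Mat -> Prop) :
  (forall i, exists k, e k = i) -> (forall i, meas (E i)) ->
  meas (fun X => exists i, E i X).
Proof.
  intros He HE. apply meas_ext with (M := fun X => exists k, E (e k) X).
  - intros X; split; [intros [k Hk]; exists (e k); auto|].
    intros [i Hi]. destruct (He i) as [k <-]; exists k; auto.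
  - apply meas_Union_nat; auto.
Qed.

Lemma meas_Inter {I : Type} (e : nat -> I) (E : I -> Mat -> Prop) :
  (forall i, exists k, e k = i) -> (forall i, meas (E i)) ->
  meas (fun X => forall i, E i X).
Proof.
  intros He HE. apply meas_ext with (M := fun X => ~ exists i, ~ E i X).
  - intros X; split; [|intros H [i Hi]; auto].
    intros H i; apply NNPP; intros Hi; apply H; exists i; auto.
  - apply meas_compl, (meas_Union e); auto. intros i; apply meas_compl; auto.
Qed.

Definition upd {T} (a : nat -> nat -> T) (i j : nat) (c : T) : nat -> nat -> T :=
  fun i' j' => if (Nat.eqb i' i && Nat.eqb j' j)%bool then c else a i' j'.

Lemma upd_same {T} (a : nat -> nat -> T) i j c : upd a i j c i j = c.
Proof. unfold upd; rewrite !Nat.eqb_refl; auto. Qed.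

Lemma upd_other {T} (a : nat -> nat -> T) i j c i' j' :
  (i' <> i \/ j' <> j) -> upd a i j c i' j' = a i' j'.
Proof.
  intros H; unfold upd.
  destruct (Nat.eqb_spec i' i), (Nat.eqb_spec j' j); simpl; auto; lia.
Qed.

Lemma upd_cases {T} (a : nat -> nat -> T) i j c i' j' :
  (i' = i /\ j' = j /\ upd a i j c i' j' = c) \/
  ((i' <> i \/ j' <> j) /\ upd a i j c i' j' = a i' j').
Proof.
  destruct (Nat.eq_dec i' i), (Nat.eq_dec j' j); subst;
    try (right; split; [tauto|apply upd_other; tauto]).
  left; rewrite upd_same; auto.
Qed.

Lemma box_vol_split (a b a1 b1 a2 b2 : Mat) i j : (i < n)%nat -> (j < m)%nat ->
  (forall i' j', (i' <> i \/ j' <> j) ->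
     b1 i' j' - a1 i' j' = b i' j' - a i' j' /\ b2 i' j' - a2 i' j' = b i' j' - a i' j') ->
  (b1 i j - a1 i j) + (b2 i j - a2 i j) = b i j - a i j ->
  box_vol n m a1 b1 + box_vol n m a2 b2 = box_vol n m a b.
Proof.
  intros Hi Hj Ho He. apply prodR_split with (i0 := i); auto.
  - intros i' _ Hne; split; apply prodR_ext; intros j' _; apply Ho; auto.
  - apply prodR_split with (i0 := j); auto.
Qed.

(** Cutting each box of a cover along the hyperplane preserves the total volume. The two hypotheses
    leave the hyperplane itself unassigned, which serves open and closed half-spaces alike. *)
Lemma meas_halfspace i j c (H : Mat -> Prop) : (i < n)%nat -> (j < m)%nat ->
  (forall X, H X -> X i j <= c) -> (forall X, ~ H X -> c <= X i j) -> meas H.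
Proof.
  intros Hi Hj H1 H2. apply meas_eps; intros A d eps He HA.
  destruct (HA eps He) as [a [b [Hab [Hs Hc]]]].
  (* This is [c] clamped to the side of the box: if the hyperplane misses the box, one of the two
     pieces is degenerate. *)
  set (cc := fun k => Rmax (a k i j) (Rmin (b k i j) c)).
  assert (Hcc : forall k, a k i j <= cc k <= b k i j).
  { intros k; unfold cc, Rmax, Rmin. specialize (Hab k i j).
    destruct (Rle_dec (b k i j) c), (Rle_dec _ _); lra. }
  set (b1 := fun k => upd (b k) i j (cc k)).
  set (a2 := fun k => upd (a k) i j (cc k)).
  assert (Hab1 : forall k i' j', a k i' j' <= b1 k i' j').
  { intros k i' j'; unfold b1.
    destruct (upd_cases (b k) i j (cc k) i' j') as [[-> [-> ->]]|[_ ->]]; auto.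
    apply Hcc. }
  assert (Hab2 : forall k i' j', a2 k i' j' <= b k i' j').
  { intros k i' j'; unfold a2.
    destruct (upd_cases (a k) i j (cc k) i' j') as [[-> [-> ->]]|[_ ->]]; auto.
    apply Hcc. }
  destruct (sum_pair_split (fun k => box_vol n m (a k) (b1 k))
    (fun k => box_vol n m (a2 k) (b k)) (d + eps)) as [c1 [c2 [Hle [Hc1 Hc2]]]].
  - intros; apply box_vol_nonneg; auto.
  - intros; apply box_vol_nonneg; auto.
  - intros N. rewrite <- sum_plus.
    erewrite sum_eq; [apply (Hs N)|].
    intros k _; simpl. apply box_vol_split with (i := i) (j := j); auto.
    + intros i' j' Hne; unfold a2, b1; rewrite !upd_other; auto.
    + unfold a2, b1; rewrite !upd_same; ring.
  - exists c1, c2; split; auto; split; intros eps' He'.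
    + exists a, b1; split; auto; split; [intros N; specialize (Hc1 N); lra|].
      intros X [HX HH]. destruct (Hc X HX) as [k Hk]; exists k.
      intros i' j' Hi' Hj'. unfold b1.
      destruct (upd_cases (b k) i j (cc k) i' j') as [[-> [-> ->]]|[_ ->]].
      * specialize (Hk i j Hi Hj). split; [lra|].
        apply H1 in HH. unfold cc.
        eapply Rle_trans; [|apply Rmax_r]. apply Rmin_glb; lra.
      * apply Hk; auto.
    + exists a2, b; split; auto; split; [intros N; specialize (Hc2 N); lra|].
      intros X [HX HH]. destruct (Hc X HX) as [k Hk]; exists k.
      intros i' j' Hi' Hj'. unfold a2.
      destruct (upd_cases (a k) i j (cc k) i' j') as [[-> [-> ->]]|[_ ->]].
      * specialize (Hk i j Hi Hj). split; [|lra].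
        apply H2 in HH. unfold cc.
        apply Rmax_lub; [lra|]. eapply Rle_trans; [apply Rmin_r|]; auto.
      * apply Hk; auto.
Qed.

(** * Dyadic grids and density *)

(** [z] is the corner and [l] the side lengths, both counted in cells of size [h]. The origin [o] is
    a parameter because the doubling law places its grid at a fixed point. *)
Definition grid_box (o : Mat) (h : R) (z : nat -> nat -> Z) (l : nat -> nat -> nat) :
  Mat -> Prop :=
  in_box n m (fun i j => o i j + h * IZR (z i j))
             (fun i j => o i j + h * (IZR (z i j) + INR (l i j))).

Definition grid_cube (o : Mat) (h : R) (z : nat -> nat -> Z) : Mat -> Prop :=
  grid_box o h z (fun _ _ => 1%nat).

Definition grid_vol (h : R) (l : nat -> nat -> nat) : R :=
  box_vol n m (fun _ _ => 0) (fun i j => h * INR (l i j)).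

Lemma grid_vol_unit h l :
  (forall i j, (i < n)%nat -> (j < m)%nat -> l i j = 1%nat) ->
  grid_vol h l = h ^ (n * m).
Proof.
  intros Hl. unfold grid_vol, box_vol.
  rewrite Nat.mul_comm, pow_mult, <- prodR_const.
  apply prodR_ext; intros i Hi. rewrite <- prodR_const.
  apply prodR_ext; intros j Hj. rewrite Hl; simpl; auto; ring.
Qed.

(** The closed cells cover the box and their volumes add up to its volume, so bounds proportional to
    volume add up. Slabs one cell thick are peeled off, one coordinate at a time. *)
Lemma ole_grid_box (S : Mat -> Prop) c o h : 0 < h ->
  (forall z, ole (fun X => grid_cube o h z X /\ S X) (c * h ^ (n * m))) ->
  forall z l, (forall i j, (i < n)%nat -> (j < m)%nat -> (1 <= l i j)%nat) ->
  ole (fun X => grid_box o h z l X /\ S X) (c * grid_vol h l).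
Proof.
  intros Hh Hc.
  (* [L] lists the coordinates along which the box may still be longer than one cell. *)
  assert (Main : forall (L : list (nat * nat)) z l,
    (forall i j, (i < n)%nat -> (j < m)%nat -> (1 <= l i j)%nat) ->
    (forall i j, (i < n)%nat -> (j < m)%nat -> ~ In (i, j) L -> l i j = 1%nat) ->
    ole (fun X => grid_box o h z l X /\ S X) (c * grid_vol h l)).
  { induction L as [|[i0 j0] L IH].
    - intros z l _ Hl.
      assert (Hl' : forall i j, (i < n)%nat -> (j < m)%nat -> l i j = 1%nat).
      { intros; apply Hl; auto. }
      rewrite grid_vol_unit; auto.
      eapply ole_mono; [|apply Rle_refl|exact (Hc z)].
      intros X [HX HS]; split; auto.
      intros i j Hi Hj. specialize (HX i j Hi Hj); simpl in HX.
      rewrite Hl' in HX; auto.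
    (* Inner induction on the length [K + 1] along [(i0, j0)]: the layer [l1] is handled by [IH],
       while the rest [l2] is shorter and starts one cell later. *)
    - assert (Inner : forall K z l, l i0 j0 = Datatypes.S K ->
        (forall i j, (i < n)%nat -> (j < m)%nat -> (1 <= l i j)%nat) ->
        (forall i j, (i < n)%nat -> (j < m)%nat -> ~ In (i, j) ((i0, j0) :: L) ->
           l i j = 1%nat) ->
        (i0 < n)%nat -> (j0 < m)%nat ->
        ole (fun X => grid_box o h z l X /\ S X) (c * grid_vol h l)).
      { induction K as [|K IHK]; intros z l HK H1 HL Hi0 Hj0.
        - apply IH; auto. intros i j Hi Hj Hnot.
          destruct (classic ((i0, j0) = (i, j))) as [E|E].
          + injection E as -> ->; auto.
          + apply HL; auto. intros [|]; auto.
        - set (l1 := upd l i0 j0 1%nat). set (l2 := upd l i0 j0 (Datatypes.S K)).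
          set (z2 := upd z i0 j0 (z i0 j0 + 1)%Z).
          assert (Hv : grid_vol h l1 + grid_vol h l2 = grid_vol h l).
          { apply box_vol_split with (i := i0) (j := j0); auto.
            - intros i j Hne; unfold l1, l2; rewrite !upd_other; auto.
            - unfold l1, l2; rewrite !upd_same, HK, (S_INR (Datatypes.S K)); simpl; ring. }
          rewrite <- Hv, Rmult_plus_distr_l.
          eapply ole_mono; [|apply Rle_refl|apply ole_union2].
          2:{ apply (IH z l1).
            - intros i j Hi Hj; unfold l1.
              destruct (upd_cases l i0 j0 1%nat i j) as [[-> [-> ->]]|[_ ->]]; auto.
            - intros i j Hi Hj Hnot; unfold l1.
              destruct (upd_cases l i0 j0 1%nat i j) as [[-> [-> ->]]|[Hne ->]]; auto.
              apply HL; auto. intros [E|]; auto. injection E as -> ->; lia. }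
          2:{ apply (IHK z2 l2); auto.
            - unfold l2; apply upd_same.
            - intros i j Hi Hj; unfold l2.
              destruct (upd_cases l i0 j0 (Datatypes.S K) i j) as [[-> [-> ->]]|[_ ->]];
                auto; lia.
            - intros i j Hi Hj Hnot; unfold l2. rewrite upd_other; auto.
              destruct (Nat.eq_dec i i0), (Nat.eq_dec j j0); auto.
              subst; exfalso; apply Hnot; left; auto. }
          intros X [HX HS].
          destruct (Rle_dec (X i0 j0) (o i0 j0 + h * (IZR (z i0 j0) + 1))) as [Hle|Hgt].
          + left; split; auto. intros i j Hi Hj; unfold l1.
            specialize (HX i j Hi Hj); simpl in HX.
            destruct (upd_cases l i0 j0 1%nat i j) as [[-> [-> ->]]|[_ ->]]; auto.
            simpl; lra.
          + right; split; auto. intros i j Hi Hj; unfold l2, z2.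
            specialize (HX i j Hi Hj); simpl in HX.
            destruct (upd_cases l i0 j0 (Datatypes.S K) i j) as [[-> [-> ->]]|[Hne ->]].
            * rewrite upd_same, plus_IZR.
              rewrite HK, (S_INR (Datatypes.S K)) in HX. lra.
            * rewrite upd_other; auto. }
      intros z l H1 HL.
      destruct (classic ((i0 < n)%nat /\ (j0 < m)%nat)) as [[Hi0 Hj0]|Hout].
      + apply (Inner (l i0 j0 - 1)%nat); auto. specialize (H1 i0 j0 Hi0 Hj0); lia.
      + apply IH; auto. intros i j Hi Hj Hnot; apply HL; auto.
        intros [E|]; auto. injection E as -> ->; auto. }
  intros z l Hl.
  apply (Main (list_prod (seq 0 n) (seq 0 m))); auto.
  intros i j Hi Hj Hnot; exfalso; apply Hnot.
  apply in_prod; apply in_seq; lia.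
Qed.

Lemma box_vol_continuity (a b : Mat) :
  continuity (fun x => box_vol n m a (fun i j => b i j + x)).
Proof.
  unfold box_vol. apply prodR_continuity with
    (f := fun i x => prodR (fun j => b i j + x - a i j) m); intros i.
  apply prodR_continuity with (f := fun j x => b i j + x - a i j); intros j.
  apply continuity_minus; [apply continuity_plus|].
  - apply continuity_const; intros x y; reflexivity.
  - apply derivable_continuous, derivable_id.
  - apply continuity_const; intros x y; reflexivity.
Qed.

(** The box is enlarged to a union of cells of a grid so fine that each side grows by at most
    [2 * h]; continuity of the volume makes the excess negligible. *)
Lemma ole_box_of_cubes (S : Mat -> Prop) c o : 0 <= c ->
  (forall N z, ole (fun X => grid_cube o ((/2) ^ N) z X /\ S X) (c * ((/2) ^ N) ^ (n * m))) ->
  forall a b : Mat, (forall i j, a i j <= b i j) ->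
  ole (fun X => in_box n m a b X /\ S X) (c * box_vol n m a b).
Proof.
  intros Hc Hcube a b Hab. apply ole_lim; intros eps He.
  (* The excess volume gets multiplied by [c]; the denominator [c + 1] stays positive when
     [c = 0]. *)
  destruct (box_vol_continuity a b 0 (eps / (c + 1))) as [d [Hd Hlim]].
  { apply Rdiv_lt_0_compat; lra. }
  destruct (pow_lt_1_zero (/2) ltac:(rewrite Rabs_pos_eq; lra) (d / 2) ltac:(lra))
    as [N HN].
  specialize (HN N (le_n N)). set (h := (/2) ^ N) in *.
  assert (Hh : 0 < h) by (apply pow_lt; lra).
  rewrite Rabs_pos_eq in HN by lra.
  set (z := fun i j => Zfloor ((a i j - o i j) / h)).
  (* [up] is strictly above its argument, so each side has at least one cell even when
     [a i j = b i j]. *)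
  set (l := fun i j => Z.to_nat (up ((b i j - o i j) / h) - z i j)).
  assert (Hz : forall i j, h * IZR (z i j) <= a i j - o i j < h * (IZR (z i j) + 1)).
  { intros i j. pose proof (Zfloor_bound ((a i j - o i j) / h)) as [H1 H2].
    fold (z i j) in H1, H2.
    replace (a i j - o i j) with (h * ((a i j - o i j) / h)) by (field; lra).
    split; [apply Rmult_le_compat_l|apply Rmult_lt_compat_l]; lra. }
  assert (Hu : forall i j, b i j - o i j < h * IZR (up ((b i j - o i j) / h))
      <= b i j - o i j + h).
  { intros i j. pose proof (archimed ((b i j - o i j) / h)) as [H1 H2].
    assert (E : b i j - o i j = h * ((b i j - o i j) / h)) by (field; lra).
    revert H1 H2 E; generalize ((b i j - o i j) / h); intros x H1 H2 ->.
    split; nra. }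
  assert (Hl : forall i j, (1 <= l i j)%nat /\
    IZR (z i j) + INR (l i j) = IZR (up ((b i j - o i j) / h))).
  { intros i j.
    assert (z i j < up ((b i j - o i j) / h))%Z.
    { apply lt_IZR, (Rmult_lt_reg_l h); auto.
      specialize (Hz i j); specialize (Hu i j); specialize (Hab i j); lra. }
    unfold l; split; [lia|].
    rewrite INR_IZR_INZ, Z2Nat.id, minus_IZR by lia; ring. }
  apply ole_mono with (S' := fun X => grid_box o h z l X /\ S X) (c := c * grid_vol h l).
  - intros X [HX HS]; split; auto. intros i j Hi Hj.
    specialize (HX i j Hi Hj). rewrite (proj2 (Hl i j)).
    specialize (Hz i j); specialize (Hu i j); lra.
  - assert (Hv : grid_vol h l <= box_vol n m a (fun i j => b i j + 2 * h)).
    { apply box_vol_le; intros i j Hi Hj. destruct (Hl i j) as [Hl1 Hl2].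
      specialize (Hz i j); specialize (Hu i j). rewrite <- Hl2 in Hu.
      apply le_INR in Hl1; simpl in Hl1. split; nra. }
    assert (Hv2 : Rabs (box_vol n m a (fun i j => b i j + 2 * h) -
      box_vol n m a (fun i j => b i j + 0)) < eps / (c + 1)).
    { apply (Hlim (2 * h)). split; [split; [exact I|lra]|].
      simpl; unfold Rdist. rewrite Rabs_pos_eq; lra. }
    rewrite (box_vol_ext a (fun i j => b i j + 0) a b) in Hv2 by (intros; lra).
    apply Rabs_def2 in Hv2.
    assert (E : c * box_vol n m a b + eps =
      c * (box_vol n m a b + eps / (c + 1)) + eps / (c + 1)) by (field; lra).
    assert (0 < eps / (c + 1)) by (apply Rdiv_lt_0_compat; lra).
    assert (c * grid_vol h l <= c * (box_vol n m a b + eps / (c + 1)));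
      [apply Rmult_le_compat_l|]; lra.
  - apply ole_grid_box; auto; [apply Hcube|]. intros; apply Hl.
Qed.

Lemma bounded_entries (X : Mat) :
  exists K : nat, forall i j, (i < n)%nat -> (j < m)%nat -> Rabs (X i j) <= INR K.
Proof.
  assert (H1 : forall (f : nat -> R) N, exists K : nat,
    forall i, (i < N)%nat -> f i <= INR K).
  { intros f; induction N as [|N [K IH]]; [exists 0%nat; lia|].
    destruct (INR_unbounded (f N)) as [K' HK'].
    exists (Nat.max K K'); intros i Hi.
    pose proof (le_INR K (Nat.max K K') ltac:(lia)).
    pose proof (le_INR K' (Nat.max K K') ltac:(lia)).
    destruct (Nat.eq_dec i N) as [->|]; [lra|].
    specialize (IH i ltac:(lia)); lra. }
  destruct (functional_choice _ (fun i => H1 (fun j => Rabs (X i j)) m)) as [f Hf].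
  destruct (H1 (fun i => INR (f i)) n) as [K HK].
  exists K; intros i j Hi Hj. specialize (Hf i j Hj); specialize (HK i Hi); simpl in *; lra.
Qed.

(** The space is exhausted by the boxes reaching from [-K] to [K + 1] around [o], each made of
    finitely many unit cubes. *)
Lemma ole_of_cubes_null (S : Mat -> Prop) o :
  (forall z, ole (fun X => grid_cube o 1 z X /\ S X) 0) -> ole S 0.
Proof.
  intros H.
  eapply ole_mono; [|apply Rle_refl|].
  2:{ apply (ole_Union_null (fun K X =>
        grid_box o 1 (fun _ _ => - Z.of_nat K)%Z (fun _ _ => 2 * K + 1)%nat X /\ S X)).
      intros K. rewrite <- (Rmult_0_l (grid_vol 1 (fun _ _ => (2 * K + 1)%nat))).
      apply ole_grid_box; [lra| |intros; lia].
      intros z; rewrite Rmult_0_l; auto. }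
  intros X HX. destruct (bounded_entries (fun i j => X i j - o i j)) as [K HK].
  exists K; split; auto. intros i j Hi Hj. specialize (HK i j Hi Hj); simpl in HK.
  rewrite opp_IZR, <- INR_IZR_INZ, plus_INR, mult_INR; simpl.
  pose proof (Rle_abs (X i j - o i j)).
  pose proof (Rle_abs (- (X i j - o i j))) as H'. rewrite Rabs_Ropp in H'. lra.
Qed.

Lemma cube_vol h o z :
  box_vol n m (fun i j => o i j + h * IZR (z i j))
    (fun i j => o i j + h * (IZR (z i j) + INR 1)) = h ^ (n * m).
Proof.
  rewrite <- (grid_vol_unit h (fun _ _ => 1%nat)) by auto.
  apply box_vol_ext; intros; simpl; ring.
Qed.

Lemma ole_grid_cube o h z : 0 < h -> ole (grid_cube o h z) (h ^ (n * m)).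
Proof.
  intros Hh. rewrite <- (cube_vol h o z).
  apply ole_box. intros; simpl; nra.
Qed.

(** A weak form of Lebesgue's density theorem. If no cube were this full, measurability would bound
    the part of [S] in each dyadic cube, hence in every box, by [1 - eps] times the volume; then [S]
    would be null. *)
Lemma density S o eps : meas S -> ~ ole S 0 -> 0 < eps < 1 ->
  exists N z, ole (fun X => grid_cube o ((/2) ^ N) z X /\ ~ S X)
                  (eps * ((/2) ^ N) ^ (n * m)).
Proof.
  intros HS Hnn He. apply NNPP; intros Hno; apply Hnn.
  assert (Hcube : forall N z, ole (fun X => grid_cube o ((/2) ^ N) z X /\ S X)
                  ((1 - eps) * ((/2) ^ N) ^ (n * m))).
  { intros N z.
    assert (Hh : 0 < (/2) ^ N) by (apply pow_lt; lra).
    destruct (HS _ _ (ole_grid_cube o _ z Hh)) as [c1 [c2 [Hle [H1 H2]]]].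
    eapply ole_mono; [|  |exact H1]; [auto|].
    assert (eps * ((/2) ^ N) ^ (n * m) < c2); [|lra].
    apply Rnot_le_lt; intros Hc2. apply Hno; exists N, z.
    eapply ole_mono; [|exact Hc2|exact H2]; auto. }
  (* Intersecting the boxes of a cover of [A] with [S] improves any bound for [A] by the factor
     [1 - eps]. *)
  assert (Hshrink : forall A c, (forall X, A X -> S X) -> ole A c -> ole A ((1 - eps) * c)).
  { intros A c HA Hc. apply ole_lim; intros d Hd.
    destruct (Hc d Hd) as [a [b [Hab [Hs Hcov]]]].
    eapply ole_mono; [| |
      apply (ole_Union (fun k X => in_box n m (a k) (b k) X /\ S X)
             (fun k => (1 - eps) * box_vol n m (a k) (b k)))].
    - intros X HX. destruct (Hcov X HX) as [k Hk]; exists k; auto.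
    - instantiate (1 := (1 - eps) * (c + d)). nra.
    - intros k. apply ole_box_of_cubes with (o := o); auto; lra.
    - intros N. rewrite (sum_eq _ (fun k => box_vol n m (a k) (b k) * (1 - eps)))
        by (intros; ring).
      rewrite <- scal_sum. apply Rmult_le_compat_l; [lra|auto]. }
  (* Inside a unit cube the outer measure [c] is finite, and [c <= (1 - eps) * c] forces it to be
     0. *)
  apply (ole_of_cubes_null S o); intros z.
  destruct (ole_inf (fun X => grid_cube o 1 z X /\ S X)) as [c [Hc Hmin]].
  { exists (1 ^ (n * m)).
    eapply ole_mono; [|apply Rle_refl|apply (ole_grid_cube o 1 z); lra]. tauto. }
  pose proof (ole_nonneg _ _ Hc).
  apply Hshrink, Hmin in Hc as Hc'; [|tauto].
  eapply ole_mono; [|  |exact Hc]; [auto|nra].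
Qed.

(** * Zero-one laws for invariant sets *)

Lemma Mat_ext (X Y : Mat) : (forall i j, X i j = Y i j) -> X = Y.
Proof.
  intros H; apply functional_extensionality; intros i.
  apply functional_extensionality; auto.
Qed.

Lemma pow_half_cancel N k : (2 ^ N) ^ k * ((/2) ^ N) ^ k = 1.
Proof. rewrite <- !Rpow_mult_distr. replace (2 * / 2) with 1 by lra. rewrite !pow1; auto. Qed.

Lemma ole_zero_of_small (S : Mat -> Prop) :
  (forall eps, 0 < eps < 1 -> ole S eps) -> ole S 0.
Proof.
  intros H; apply ole_lim; intros eps He.
  apply ole_mono with (S' := S) (c := Rmin eps (/2)); auto.
  - rewrite Rplus_0_l; apply Rmin_l.
  - apply H. unfold Rmin; destruct (Rle_dec _ _); lra.
Qed.

(* The grid is placed at the fixed point [-t] of [X |-> 2 X + t], so that the map sends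
   the cubes of level [N + 1] onto those of level [N]. *)
Lemma zero_one_doubling (G : Mat -> Prop) (t : Mat) : meas G ->
  (forall X, G X -> G (fun i j => 2 * X i j + t i j)) ->
  (forall X (A : nat -> nat -> Z), G X -> G (fun i j => X i j + IZR (A i j))) ->
  ole G 0 \/ ole (fun X => ~ G X) 0.
Proof.
  intros HG H2 HZ. destruct (classic (ole G 0)) as [|Hnn]; [auto|right].
  (* Under iteration the translations accumulate to [t] times the geometric sum [2 ^ N - 1]. *)
  assert (Hit : forall N X, G X -> G (fun i j => 2 ^ N * X i j + (2 ^ N - 1) * t i j)).
  { induction N as [|N IH]; intros X HX.
    - replace (fun i j => _) with X; auto. apply Mat_ext; intros; simpl; ring.
    - apply IH, H2 in HX.
      replace (fun i j => _) with
        (fun i j => 2 * (2 ^ N * X i j + (2 ^ N - 1) * t i j) + t i j); auto.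
      apply Mat_ext; intros; simpl; ring. }
  apply (ole_of_cubes_null _ (fun i j => - t i j)); intros z'.
  apply ole_zero_of_small; intros eps He.
  destruct (density G (fun i j => - t i j) eps HG Hnn He) as [N [z Hz]].
  apply ole_mono with (S' := fun X => grid_cube (fun i j => - t i j) 1 z' X /\ ~ G X)
    (c := (2 ^ N) ^ (n * m) * (eps * ((/2) ^ N) ^ (n * m))); auto.
  { pose proof (pow_half_cancel N (n * m)). nra. }
  assert (Hp : 0 < 2 ^ N) by (apply pow_lt; lra).
  (* The [N]-fold iterate followed by the integer shift [z' - z] maps the dense cube of level [N]
     onto the unit cube at [z'], and the scaling of volume turns the proportion [eps] into the bound
     [eps]. *)
  apply ole_affine with (t := fun i j => (2 ^ N - 1) * t i j + IZR (z' i j - z i j)) (2 := Hz);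
    auto.
  intros X [HX HnG]; split.
  - intros i j Hi Hj. specialize (HX i j Hi Hj); simpl in *.
    rewrite minus_IZR, pow_inv.
    assert (Hu : 0 < / 2 ^ N) by (apply Rinv_0_lt_compat; auto).
    split; apply Rminus_le.
    + replace (_ - _) with (/ 2 ^ N * (- t i j + 1 * IZR (z' i j) - X i j))
        by (field; lra). nra.
    + replace (_ - _) with (/ 2 ^ N * (X i j - (- t i j + 1 * (IZR (z' i j) + 1))))
        by (field; lra). nra.
  - intros HY; apply HnG. apply (Hit N), (HZ _ (fun i j => z' i j - z i j)%Z) in HY.
    replace X with (fun i j => 2 ^ N * ((X i j - ((2 ^ N - 1) * t i j +
       IZR (z' i j - z i j))) / 2 ^ N) + (2 ^ N - 1) * t i j + IZR (z' i j - z i j)); auto.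
    apply Mat_ext; intros; field; lra.
Qed.

(** In some dyadic cube [F] fills all but a proportion [eps], and so does the [G] chosen for its
    level; translations copy this to every cube of that level, and summing over the cubes of the
    unit cube leaves at most [eps] outside [F]. As the level depends on [eps], one invariant [G] per
    level is enough. *)
Lemma zero_one_translation (F : Mat -> Prop) : meas F ->
  (forall N, exists G : Mat -> Prop, (forall X, G X -> F X) /\
     ole (fun X => F X /\ ~ G X) 0 /\
     forall X (A : nat -> nat -> Z), G X -> G (fun i j => X i j + (/2) ^ N * IZR (A i j))) ->
  ole F 0 \/ ole (fun X => in_cube n m X /\ ~ F X) 0.
Proof.
  intros HF Hinv. destruct (classic (ole F 0)) as [|Hnn]; [auto|right].
  apply ole_zero_of_small; intros eps He.
  destruct (density F (fun _ _ => 0) eps HF Hnn He) as [N [z Hz]].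
  destruct (Hinv N) as [G [HGF [Hnull HG]]].
  set (h := (/2) ^ N) in *.
  assert (Hh : 0 < h) by (apply pow_lt; lra).
  assert (HzG : ole (fun X => grid_cube (fun _ _ => 0) h z X /\ ~ G X)
    (eps * h ^ (n * m) + 0)).
  { eapply ole_mono; [|apply Rle_refl|exact (ole_union2 _ _ _ _ Hz Hnull)].
    intros X [HX HnG]; simpl. destruct (classic (F X)); auto. }
  rewrite Rplus_0_r in HzG.
  assert (Hall : forall z', ole (fun X => grid_cube (fun _ _ => 0) h z' X /\ ~ G X)
    (eps * h ^ (n * m))).
  { intros z'. rewrite <- (Rmult_1_l (eps * _)), <- (pow1 (n * m)).
    apply ole_affine with (t := fun i j => h * IZR (z' i j - z i j)) (2 := HzG); [lra|].
    intros X [HX HnG]; split.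
    - intros i j Hi Hj. specialize (HX i j Hi Hj); simpl in *.
      rewrite minus_IZR. lra.
    - intros HY; apply HnG. apply (HG _ (fun i j => z' i j - z i j)%Z) in HY.
      replace X with (fun i j => (X i j - h * IZR (z' i j - z i j)) / 1
         + h * IZR (z' i j - z i j)); auto.
      apply Mat_ext; intros; field. }
  assert (Hh2 : h * INR (2 ^ N) = 1).
  { unfold h. rewrite pow_INR, <- Rpow_mult_distr; simpl INR.
    replace (/ 2 * (1 + 1)) with 1 by lra. apply pow1. }
  assert (Hv : grid_vol h (fun _ _ => 2 ^ N)%nat = 1).
  { rewrite <- (pow1 (n * m)), <- (grid_vol_unit 1 (fun _ _ => 1%nat)) by auto.
    apply box_vol_ext; intros; simpl (INR 1); lra. }
  rewrite <- (Rmult_1_r eps), <- Hv.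
  eapply ole_mono; [|apply Rle_refl|
    apply (ole_grid_box (fun X => ~ G X) eps _ h Hh Hall (fun _ _ => 0%Z))].
  - intros X [HX HnF]; split; auto. intros i j Hi Hj.
    specialize (HX i j Hi Hj). rewrite !Rplus_0_l, Hh2; lra.
  - intros i j _ _. pose proof (Nat.pow_nonzero 2 N); lia.
Qed.
End OuterMeasure.

(** * Countable enumerations and linear forms *)

Definition enum_Z (k : nat) : Z := (Z.of_nat (fst (of_nat k)) - Z.of_nat (snd (of_nat k)))%Z.

Lemma enum_Z_surj z : exists k, enum_Z k = z.
Proof.
  exists (to_nat (Z.to_nat z, Z.to_nat (- z))). unfold enum_Z.
  rewrite cancel_of_to; simpl; lia.
Qed.

Definition enum_pair {A B} (e : nat -> A) (f : nat -> B) (k : nat) : A * B :=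
  (e (fst (of_nat k)), f (snd (of_nat k))).

Lemma enum_pair_surj {A B} (e : nat -> A) (f : nat -> B) :
  (forall x, exists k, e k = x) -> (forall y, exists k, f k = y) ->
  forall p, exists k, enum_pair e f k = p.
Proof.
  intros He Hf [x y]. destruct (He x) as [k <-], (Hf y) as [l <-].
  exists (to_nat (k, l)). unfold enum_pair; rewrite cancel_of_to; auto.
Qed.

Fixpoint enum_word {A} (e : nat -> A) (len k : nat) : list A :=
  match len with
  | O => []
  | S len' => e (fst (of_nat k)) :: enum_word e len' (snd (of_nat k))
  end.

Definition enum_list {A} (e : nat -> A) (k : nat) : list A :=
  enum_word e (fst (of_nat k)) (snd (of_nat k)).

Lemma enum_list_surj {A} (e : nat -> A) :
  (forall x, exists k, e k = x) -> forall l, exists k, enum_list e k = l.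
Proof.
  intros He l.
  assert (H : exists k, enum_word e (length l) k = l).
  { induction l as [|x l [k IH]]; [exists 0%nat; auto|].
    destruct (He x) as [j <-]. exists (to_nat (j, k)).
    cbn [length enum_word]; rewrite cancel_of_to; cbn [fst snd]; rewrite IH; auto. }
  destruct H as [k Hk]. exists (to_nat (length l, k)).
  unfold enum_list; rewrite cancel_of_to; auto.
Qed.

Definition enum_rat (k : nat) : R :=
  IZR (enum_Z (fst (of_nat k))) / INR (S (snd (of_nat k))).

Lemma enum_rat_dense x y : x < y -> exists k, x < enum_rat k < y.
Proof.
  intros Hxy.
  destruct (INR_archimed (y - x) 1 ltac:(lra)) as [N HN].
  assert (HS : 0 < INR (S N)) by apply lt_0_INR, Nat.lt_0_succ.
  assert (HN' : 1 < INR (S N) * (y - x)) by (rewrite S_INR; nra).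
  pose proof (archimed (x * INR (S N))) as [H1 H2].
  destruct (enum_Z_surj (up (x * INR (S N)))) as [j Hj].
  exists (to_nat (j, N)). unfold enum_rat.
  rewrite cancel_of_to; cbn [fst snd]; rewrite Hj.
  split; apply (Rmult_lt_reg_r (INR (S N))); auto;
    unfold Rdiv; rewrite ?Rmult_assoc, ?Rinv_l, ?Rmult_1_r; lra.
Qed.

Section LinearForms.

Variables n m : nat.
Hypothesis Hn : (1 <= n)%nat.
Hypothesis Hm : (1 <= m)%nat.

Definition mfun (f : Mat -> R) : Prop := forall c, meas n m (fun X => f X < c).

(** A rational between [f X] and [c - g X] turns the sublevel condition into a countable union. *)
Lemma mfun_plus f g : mfun f -> mfun g -> mfun (fun X => f X + g X).
Proof.
  intros Hf Hg c.
  apply meas_ext with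
    (M := fun X => exists k, f X < enum_rat k /\ g X < c - enum_rat k).
  - intros X; split; [intros [k Hk]; lra|].
    intros H. destruct (enum_rat_dense (f X) (c - g X)) as [k Hk]; [lra|].
    exists k; lra.
  - apply meas_Union_nat; auto. intros k; apply meas_inter; auto.
Qed.

Lemma mfun_const c : mfun (fun _ => c).
Proof. intros d; apply meas_const; auto. Qed.

Lemma mfun_entry u i j : (i < n)%nat -> (j < m)%nat -> mfun (fun X => u * X i j).
Proof.
  intros Hi Hj c. destruct (Rtotal_order u 0) as [Hu|[->|Hu]].
  - apply meas_ext with (M := fun X => ~ X i j <= c / u).
    + intros X. assert (E : c = u * (c / u)) by (field; lra).
      split; intros H.
      * apply Rnot_le_lt in H. rewrite E; nra.
      * intros H'. rewrite E in H. nra.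
    + apply meas_compl, (meas_halfspace n m) with (i := i) (j := j) (c := c / u); auto.
      intros X H; lra.
  - apply meas_ext with (M := fun _ => 0 < c); [|apply meas_const; auto].
    intros X; rewrite Rmult_0_l; tauto.
  - apply meas_ext with (M := fun X => X i j < c / u).
    + intros X. assert (E : c = u * (c / u)) by (field; lra).
      split; intros H.
      * rewrite E; nra.
      * rewrite E in H. nra.
    + apply (meas_halfspace n m) with (i := i) (j := j) (c := c / u); auto; intros X H; lra.
Qed.

Lemma mfun_linear (u : nat -> R) j N : (j < m)%nat -> (N <= n)%nat ->
  mfun (fun X => sumR (fun i => u i * X i j) N).
Proof.
  intros Hj; induction N as [|N IH]; intros HN; simpl.
  - apply mfun_const.
  - apply mfun_plus; [apply IH; lia|apply mfun_entry; auto].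
Qed.

Lemma sumR_ext f g N : (forall i, (i < N)%nat -> f i = g i) -> sumR f N = sumR g N.
Proof. induction N as [|N IH]; intros H; simpl; auto. rewrite (H N), IH; auto. Qed.

Lemma sumR_scal c f N : sumR (fun i => c * f i) N = c * sumR f N.
Proof. induction N as [|N IH]; simpl; [ring|]. rewrite IH; ring. Qed.

Lemma sumR_plus f g N : sumR (fun i => f i + g i) N = sumR f N + sumR g N.
Proof. induction N as [|N IH]; simpl; [ring|]. rewrite IH; ring. Qed.

Lemma meas_approx_ineq p q psi : meas n m (fun X => approx_ineq n m X p q psi).
Proof.
  unfold approx_ineq.
  assert (H : forall N, (N <= m)%nat -> meas n m (fun X =>
    forall j, (j < N)%nat -> Rabs (qX n q X j + IZR (nth j p 0%Z)) < psi)).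
  { induction N as [|N IH]; intros HN.
    - apply meas_ext with (M := fun _ => True); [|apply meas_const; auto].
      intros X; split; auto; lia.
    - apply meas_ext with (M := fun X =>
        (forall j, (j < N)%nat -> Rabs (qX n q X j + IZR (nth j p 0%Z)) < psi) /\
        (qX n q X N < psi - IZR (nth N p 0%Z) /\
         sumR (fun i => - IZR (nth i q 0%Z) * X i N) n < psi + IZR (nth N p 0%Z))).
      + intros X.
        assert (E : sumR (fun i => - IZR (nth i q 0%Z) * X i N) n = - qX n q X N).
        { rewrite <- (Rmult_1_l (qX n q X N)), <- Ropp_mult_distr_l_reverse.
          unfold qX; rewrite <- sumR_scal. apply sumR_ext; intros; ring. }
        rewrite E; split.
        * intros [H1 [H2 H3]] j Hj.
          destruct (Nat.eq_dec j N) as [->|]; [|apply H1; lia].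
          apply Rabs_def1; lra.
        * intros H; split; [intros; apply H; lia|].
          specialize (H N (Nat.lt_succ_diag_r N)). apply Rabs_def2 in H; lra.
      + apply meas_inter; auto; [apply IH; lia|].
        apply meas_inter; auto; apply mfun_linear; lia. }
  apply H; auto.
Qed.

(** * The limsup sets restricted to a class of [q] *)

Definition good (v : variant) (p q : list Z) : Prop :=
  length p = m /\ length q = n /\ q <> repeat 0%Z n /\ coprime_cond v m p q.

(* The paper's set, extended periodically to the whole space and with [q] confined to [P]. *)
Definition Fset (v : variant) (Psi : list Z -> R) (P : list Z -> Prop) (X : Mat) : Prop :=
  exists k : nat, forall L : list (list Z * list Z), exists p q,
    good v p q /\ P q /\ approx_ineq n m X p q (INR k * Psi q) /\ ~ In (p, q) L.

Lemma F_set_iff v Psi X : (forall q, length q = n -> 0 < Psi q) ->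
  F_set v n m Psi X <-> in_cube n m X /\ Fset v Psi (fun _ => True) X.
Proof.
  intros HPsi; split.
  - intros [k [_ [Hc H]]]; split; auto. exists k; intros L.
    destruct (H L) as [p [q [H1 [H2 [H3 [H4 [H5 H6]]]]]]].
    exists p, q; unfold good; auto.
  (* [Fset] admits [k = 0]; replacing [k] by [S k] only weakens the inequality, as [Psi] is
     positive. *)
  - intros [Hc [k H]]. exists (S k); split; [lia|split; auto].
    intros L. destruct (H L) as [p [q [[H1 [H2 [H3 H4]]] [_ [H5 H6]]]]].
    exists p, q; do 5 (split; auto).
    intros j Hj. eapply Rlt_le_trans; [apply H5; auto|].
    apply Rmult_le_compat_r; [apply Rlt_le; auto|]. apply le_INR; lia.
Qed.

Lemma Fset_mono v Psi (P Q : list Z -> Prop) X :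
  (forall q, length q = n -> P q -> Q q) -> Fset v Psi P X -> Fset v Psi Q X.
Proof.
  intros H [k Hk]; exists k; intros L.
  destruct (Hk L) as [p [q [Hg [HP HL]]]].
  exists p, q; do 2 (split; auto). apply H; auto; apply Hg.
Qed.

(** If for one [k] the solutions in [P] and those in [Q] were each exhausted by a finite list, the
    concatenated list would exhaust them all. *)
Lemma Fset_or v Psi (P Q : list Z -> Prop) X :
  Fset v Psi (fun q => P q \/ Q q) X -> Fset v Psi P X \/ Fset v Psi Q X.
Proof.
  intros [k H]. apply NNPP; intros Hno. apply not_or_and in Hno as [H1 H2].
  destruct (not_all_ex_not _ _ (not_ex_all_not _ _ H1 k)) as [L1 HL1].
  destruct (not_all_ex_not _ _ (not_ex_all_not _ _ H2 k)) as [L2 HL2].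
  destruct (H (L1 ++ L2)) as [p [q [Hg [HPQ [Ha Hni]]]]].
  rewrite in_app_iff in Hni.
  destruct HPQ; [apply HL1|apply HL2]; exists p, q; tauto.
Qed.

Lemma Fset_exists v Psi (P : nat -> list Z -> Prop) N X :
  Fset v Psi (fun q => exists i, (i < N)%nat /\ P i q) X ->
  exists i, (i < N)%nat /\ Fset v Psi (P i) X.
Proof.
  induction N as [|N IH]; intros H.
  - destruct H as [k H]. destruct (H []) as [p [q [_ [[i [Hi _]] _]]]]; lia.
  - apply Fset_mono with (Q := fun q => (exists i, (i < N)%nat /\ P i q) \/ P N q) in H.
    + apply Fset_or in H as [H|H]; [|exists N; auto].
      destruct (IH H) as [i [Hi Hf]]; exists i; auto.
    + intros q _ [i [Hi HP]]. destruct (Nat.eq_dec i N) as [->|]; auto.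
      left; exists i; split; auto; lia.
Qed.

(** All quantifiers, over [k], finite lists [L] and vectors [p], [q], range over countable types,
    and the innermost conditions are measurable. *)
Lemma meas_Fset v Psi P : meas n m (Fset v Psi P).
Proof.
  pose proof (enum_list_surj _ enum_Z_surj) as HE.
  pose proof (enum_pair_surj _ _ HE HE) as HE2.
  apply meas_Union_nat; auto; intros k.
  apply (meas_Inter _ _ Hn Hm (enum_list (enum_pair (enum_list enum_Z) (enum_list enum_Z)))).
  { apply enum_list_surj; auto. }
  intros L.
  apply (meas_Union _ _ Hn Hm (enum_list enum_Z)); auto; intros p.
  apply (meas_Union _ _ Hn Hm (enum_list enum_Z)); auto; intros q.
  apply meas_inter; auto; [apply meas_const; auto|].
  apply meas_inter; auto; [apply meas_const; auto|].
  apply meas_inter; auto; [apply meas_approx_ineq|apply meas_const; auto].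
Qed.

Lemma qX_affine q c X t j :
  qX n q (fun i j => c * X i j + t i j) j = c * qX n q X j + qX n q t j.
Proof.
  unfold qX. rewrite <- sumR_scal, <- sumR_plus. apply sumR_ext; intros; ring.
Qed.

(** * Coprimality *)

Definition divides_all (d : Z) (l : list Z) : Prop := forall x, In x l -> (d | x)%Z.

Lemma gcd_list_divides l : divides_all (gcd_list l) l.
Proof.
  induction l as [|y l IH]; intros x Hx; [contradiction|].
  destruct Hx as [<-|Hx]; [apply Z.gcd_divide_l|].
  eapply Z.divide_trans; [apply Z.gcd_divide_r|apply IH; auto].
Qed.

Lemma gcd_list_greatest d l : divides_all d l -> (d | gcd_list l)%Z.
Proof.
  induction l as [|y l IH]; intros H; simpl; [apply Z.divide_0_r|].
  apply Z.gcd_greatest; [apply H; left; auto|].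
  apply IH; intros x Hx; apply H; right; auto.
Qed.

Lemma gcd_list_eq1 l :
  gcd_list l = 1%Z <-> ~ exists d, (1 < d)%Z /\ divides_all d l.
Proof.
  split.
  - intros H [d [Hd Hl]]. apply gcd_list_greatest in Hl. rewrite H in Hl.
    apply Z.divide_1_r in Hl; lia.
  - intros H. pose proof (gcd_list_divides l) as Hg.
    assert (0 <= gcd_list l)%Z.
    { destruct l; simpl; [lia|apply Z.gcd_nonneg]. }
    (* A vanishing gcd means that all entries are 0, and then 2 is a common divisor. *)
    destruct (Z.eq_dec (gcd_list l) 0) as [E|E].
    + exfalso; apply H; exists 2%Z; split; [lia|].
      intros x Hx; apply Hg in Hx; rewrite E in Hx.
      apply Z.divide_0_l in Hx as ->; apply Z.divide_0_r.
    + destruct (Z.eq_dec (gcd_list l) 1) as [E1|E1]; auto.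
      exfalso; apply H; exists (gcd_list l); split; [lia|auto].
Qed.

(* The divisor is allowed to change, from [d] to [d'], because in the translation case
   only the radical of [d] survives. *)
Lemma coprime_cond_transfer v (p p' q : list Z) : length p = m -> length p' = m ->
  (forall d, (1 < d)%Z -> divides_all d q -> exists d', (1 < d')%Z /\ divides_all d' q /\
     forall j, (j < m)%nat -> (d | nth j p' 0)%Z -> (d' | nth j p 0)%Z) ->
  coprime_cond v m p q -> coprime_cond v m p' q.
Proof.
  intros Hp Hp' H; destruct v; simpl; auto.
  - rewrite !gcd_list_eq1. intros Hno [d [Hd Hall]]; apply Hno.
    destruct (H d Hd) as [d' [Hd' [Hq Hj]]].
    { intros x Hx; apply Hall, in_app_iff; auto. }
    exists d'; split; auto. intros x Hx. apply in_app_iff in Hx as [Hx|Hx]; auto.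
    destruct (In_nth _ _ 0%Z Hx) as [j [Hjl <-]]. rewrite Hp in Hjl.
    apply Hj; auto. apply Hall, in_app_iff; left. apply nth_In; lia.
  - intros Hno j Hjm. specialize (Hno j Hjm). revert Hno.
    change (gcd_list (nth j p 0%Z :: q) = 1%Z -> gcd_list (nth j p' 0%Z :: q) = 1%Z).
    rewrite !gcd_list_eq1. intros Hno [d [Hd Hall]]; apply Hno.
    destruct (H d Hd) as [d' [Hd' [Hq Hj]]].
    { intros x Hx; apply Hall; right; auto. }
    exists d'; split; auto. intros x [<-|Hx]; auto.
    apply Hj; auto. apply Hall; left; auto.
Qed.

(** This lets infinitude pass along an injective relation: to find an image outside [L], take a
    solution outside the finite preimage of [L]. *)
Lemma preimage_list {A B} (Rel : A -> B -> Prop) (L : list B) :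
  (forall x x' y, Rel x y -> Rel x' y -> x = x') ->
  exists L', forall x y, Rel x y -> In y L -> In x L'.
Proof.
  intros Hinj; induction L as [|y L [L' IH]]; [exists []; auto|].
  destruct (classic (exists x, Rel x y)) as [[x0 Hx0]|Hno].
  - exists (x0 :: L'); intros x y' Hr [<-|Hin]; [left; eauto|right; eauto].
  - exists L'; intros x y' Hr [<-|Hin]; [exfalso; eauto|eauto].
Qed.

(* If [|q X + p| < psi] then [|q (c X + t) + (c p - q t)| < c psi], so it suffices that
   [q t] is integral and that [(c p - q t, q)] inherits the coprimality of [(p, q)]. *)
Lemma Fset_affine v Psi (P : list Z -> Prop) (c : nat) (t : Mat) : (1 <= c)%nat ->
  (forall q, length q = n -> P q -> exists w : nat -> Z,
     (forall j, (j < m)%nat -> IZR (w j) = qX n q t j) /\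
     forall d, (1 < d)%Z -> divides_all d q -> exists d', (1 < d')%Z /\ divides_all d' q /\
       forall j x, (j < m)%nat -> (d | Z.of_nat c * x - w j)%Z -> (d' | x)%Z) ->
  forall X, Fset v Psi P X -> Fset v Psi P (fun i j => INR c * X i j + t i j).
Proof.
  (* The constant [c * k] absorbs the dilation, which the union over all [k] permits. *)
  intros Hc Hw X [k H]. exists (c * k)%nat; intros L.
  (* [Rel x y] says that the affine map sends the solution [x] to [y]; it is injective as [c] is
     nonzero. *)
  set (Rel := fun x y : list Z * list Z => snd x = snd y /\
    length (fst x) = m /\ forall j, (j < m)%nat ->
      IZR (nth j (fst y) 0%Z) = INR c * IZR (nth j (fst x) 0%Z) - qX n (snd x) t j).
  assert (Hc' : 1 <= INR c) by (apply (le_INR 1); auto).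
  destruct (preimage_list Rel L) as [L' HL'].
  { intros [p q] [p' q'] [p'' q''] [H1 [H2 H3]] [H1' [H2' H3']]; simpl in *; subst.
    f_equal. apply (nth_ext _ _ 0%Z 0%Z); [lia|]. intros j Hj.
    rewrite H2 in Hj. specialize (H3 j Hj); specialize (H3' j Hj).
    apply eq_IZR, (Rmult_eq_reg_l (INR c)); lra. }
  destruct (H L') as [p [q [[Hp [Hq [Hq0 Hcop]]] [HP [Ha Hni]]]]].
  destruct (Hw q Hq HP) as [w [Hwt Hwd]].
  set (p' := map (fun j => Z.of_nat c * nth j p 0 - w j)%Z (seq 0 m)).
  assert (Hp' : forall j, (j < m)%nat -> nth j p' 0%Z = (Z.of_nat c * nth j p 0 - w j)%Z).
  { intros j Hj; unfold p'.
    rewrite (nth_indep _ 0%Z (Z.of_nat c * nth 0 p 0 - w 0%nat)%Z)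
      by (rewrite length_map, length_seq; auto).
    rewrite (map_nth (fun j => Z.of_nat c * nth j p 0 - w j)%Z (seq 0 m) 0%nat).
    rewrite seq_nth; auto. }
  assert (Hlen : length p' = m) by (unfold p'; rewrite length_map, length_seq; auto).
  assert (HR : forall j, (j < m)%nat ->
    IZR (nth j p' 0%Z) = INR c * IZR (nth j p 0%Z) - qX n q t j).
  { intros j Hj. rewrite Hp', minus_IZR, mult_IZR, <- INR_IZR_INZ, Hwt; auto. }
  exists p', q; split; [split; [auto|split; [auto|split; [auto|]]]|split; [auto|split]].
  - apply coprime_cond_transfer with (p := p); auto.
    intros d Hd Hdq. destruct (Hwd d Hd Hdq) as [d' [Hd' [Hdq' Hj]]].
    exists d'; split; auto; split; auto. intros j Hjm Hdiv.
    rewrite Hp' in Hdiv; eauto.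
  - intros j Hj. specialize (Ha j Hj).
    rewrite qX_affine, HR by auto.
    replace (_ + _) with (INR c * (qX n q X j + IZR (nth j p 0%Z))) by ring.
    rewrite Rabs_mult, Rabs_pos_eq, mult_INR, Rmult_assoc by lra.
    apply Rmult_lt_compat_l; lra.
  - intros Hin; apply Hni. apply (HL' (p, q) (p', q)); auto.
    split; [auto|split; auto].
Qed.

(** * Splitting by the 2-adic valuation of [q] *)

(** The vector [q] has 2-adic valuation exactly [a], attained at the entry [i]. *)
Definition exact_pow2 (a i : nat) (q : list Z) : Prop :=
  divides_all (2 ^ Z.of_nat a) q /\ exists y, Z.Odd y /\ nth i q 0%Z = (2 ^ Z.of_nat a * y)%Z.

Definition multiple_pow2 (a : nat) (q : list Z) : Prop := divides_all (2 ^ Z.of_nat a) q.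

Lemma pow2_S a : (2 ^ Z.of_nat (S a) = 2 * 2 ^ Z.of_nat a)%Z.
Proof. rewrite Nat2Z.inj_succ, Z.pow_succ_r; lia. Qed.

Lemma pow2_pos a : (0 < 2 ^ Z.of_nat a)%Z.
Proof. apply Z.pow_pos_nonneg; lia. Qed.

Lemma odd_coprime_pow2 d a : Z.Odd d -> Z.gcd d (2 ^ Z.of_nat a) = 1%Z.
Proof.
  intros [u ->]. apply Zgcd_1_rel_prime.
  induction a as [|a IH]; [apply rel_prime_sym, rel_prime_1|].
  rewrite pow2_S. apply rel_prime_mult; auto.
  apply bezout_rel_prime, (Bezout_intro _ _ _ 1 (- u)); lia.
Qed.

Lemma multiple_pow2_step a q : length q = n -> multiple_pow2 a q ->
  multiple_pow2 (S a) q \/ exists i, (i < n)%nat /\ exact_pow2 a i q.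
Proof.
  intros Hq Ha. destruct (classic (multiple_pow2 (S a) q)) as [|Hno]; [auto|right].
  apply not_all_ex_not in Hno as [x Hx]. apply imply_to_and in Hx as [Hin Hx].
  destruct (Ha x Hin) as [y Hy]. destruct (In_nth _ _ 0%Z Hin) as [i [Hi E]].
  exists i; split; [lia|split; auto]. exists y; split; [|lia].
  destruct (Z.Even_or_Odd y) as [[u ->]|]; auto.
  exfalso; apply Hx; exists u. rewrite pow2_S; lia.
Qed.

(** At each level the class splits into the multiples of the next power of 2 and finitely many exact
    classes, one per entry, so one of the pieces retains infinitely many solutions. *)
Lemma Fset_pow2_cases v Psi X N : Fset v Psi (fun _ => True) X ->
  Fset v Psi (multiple_pow2 N) X \/
  exists a i, (i < n)%nat /\ Fset v Psi (exact_pow2 a i) X.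
Proof.
  intros H; induction N as [|N [IH|IH]]; [left| |right; auto].
  - apply Fset_mono with (P := fun _ => True); auto.
    intros q _ _ x _; apply Z.divide_1_l.
  - apply Fset_mono with (Q := fun q => multiple_pow2 (S N) q \/
      exists i, (i < n)%nat /\ exact_pow2 N i q) in IH.
    + apply Fset_or in IH as [|IH]; [left; auto|right].
      apply Fset_exists in IH as [i [Hi HF]]; exists N, i; auto.
    + apply multiple_pow2_step.
Qed.

Lemma qX_row q i0 c j : (i0 < n)%nat ->
  qX n q (fun i _ => if Nat.eqb i i0 then c else 0) j = IZR (nth i0 q 0%Z) * c.
Proof.
  unfold qX. assert (H : forall N,
    sumR (fun i => IZR (nth i q 0%Z) * (if Nat.eqb i i0 then c else 0)) N =
    if Nat.ltb i0 N then IZR (nth i0 q 0%Z) * c else 0).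
  { induction N as [|N IH]; [reflexivity|]. simpl sumR; rewrite IH.
    destruct (Nat.ltb_spec i0 N), (Nat.ltb_spec i0 (S N)), (Nat.eqb_spec N i0);
      subst; lia || ring. }
  intros Hi. rewrite H. destruct (Nat.ltb_spec i0 n); auto; lia.
Qed.

(** [w] is the [j]-th entry of [(q / d) A], so it inherits the common divisors of the entries of
    [q / d]; the division is encoded by asking for [d * x] in [q]. *)
Lemma qX_integral (d : Z) q (A : nat -> nat -> Z) j :
  divides_all d q -> d <> 0%Z -> exists w : Z,
    IZR w * IZR d = qX n q (fun i j => IZR (A i j)) j /\
    forall e, (forall x, In (d * x)%Z q -> (e | x)%Z) -> (e | w)%Z.
Proof.
  intros Hd Hd0. unfold qX.
  clear Hn; induction n as [|N IH]; simpl.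
  - exists 0%Z; split; [ring|intros; apply Z.divide_0_r].
  - destruct IH as [w [Hw He]].
    (* A position beyond the end of [q] reads the default 0 and contributes nothing. *)
    destruct (nth_in_or_default N q 0%Z) as [Hin| ->].
    + destruct (Hd _ Hin) as [x Hx]. exists (w + x * A N j)%Z; split.
      * rewrite <- Hw, Hx, plus_IZR, !mult_IZR; ring.
      * intros e Hall. apply Z.divide_add_r; auto.
        apply Z.divide_mul_l, Hall. rewrite Z.mul_comm, <- Hx; auto.
    + exists w; split; auto. rewrite <- Hw; ring.
Qed.

(** Here [w = q A], which every common divisor of [q] divides, so [d] itself can be kept. *)
Lemma Fset_translate_integer v Psi P X (A : nat -> nat -> Z) :
  Fset v Psi P X -> Fset v Psi P (fun i j => X i j + IZR (A i j)).
Proof.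
  intros HX.
  replace (fun i j => _) with (fun i j => INR 1 * X i j + IZR (A i j))
    by (apply Mat_ext; intros; simpl; ring).
  apply Fset_affine; auto. intros q Hq _.
  assert (Hd1 : divides_all 1 q) by (intros x _; apply Z.divide_1_l).
  destruct (functional_choice _ (fun j => qX_integral 1 q A j Hd1 ltac:(lia))) as [w Hw].
  exists w; split.
  - intros j _. destruct (Hw j) as [<- _]; ring.
  - intros d Hd Hdq. exists d; split; [auto|split; [auto|]].
    intros j x _ Hdiv.
    assert (d | w j)%Z.
    { apply Hw. intros y Hy; apply Hdq. rewrite Z.mul_1_l in Hy; auto. }
    replace x with (Z.of_nat 1 * x - w j + w j)%Z by lia.
    apply Z.divide_add_r; auto.
Qed.

(** The spare factor of 2 in [2^(N+1)] makes [w = q A / 2^N] even. An odd common divisor of [q]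
    divides [w] and is kept; an even one may fail to, but can be replaced by 2. *)
Lemma Fset_translate_dyadic v Psi N X (A : nat -> nat -> Z) :
  Fset v Psi (multiple_pow2 (S N)) X ->
  Fset v Psi (multiple_pow2 (S N)) (fun i j => X i j + (/2) ^ N * IZR (A i j)).
Proof.
  intros HX.
  replace (fun i j => _) with (fun i j => INR 1 * X i j + (/2) ^ N * IZR (A i j))
    by (apply Mat_ext; intros; simpl; ring).
  apply Fset_affine; auto. intros q Hq HP.
  assert (HD : divides_all (2 ^ Z.of_nat N) q).
  { intros x Hx. eapply Z.divide_trans; [|apply HP; auto].
    rewrite pow2_S; apply Z.divide_factor_r. }
  pose proof (pow2_pos N) as Hpos.
  destruct (functional_choice _ (fun j => qX_integral _ q A j HD ltac:(lia))) as [w Hw].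
  assert (Hpow : (/2) ^ N * IZR (2 ^ Z.of_nat N) = 1).
  { rewrite <- pow_IZR, <- Rpow_mult_distr. replace (/ 2 * 2) with 1 by lra. apply pow1. }
  exists w; split.
  - intros j _. destruct (Hw j) as [Hwj _].
    replace (qX n q _ j) with ((/2) ^ N * qX n q (fun i j => IZR (A i j)) j).
    + rewrite <- Hwj, (Rmult_comm (IZR (w j))), <- Rmult_assoc, Hpow; ring.
    + unfold qX; rewrite <- sumR_scal; apply sumR_ext; intros; ring.
  - intros d Hd Hdq.
    (* A common divisor [e] of [q] divides the entries of [q / 2^N] if it divides 2, since these
       entries are even, or if it is coprime to [2^N], by Gauss's lemma. *)
    assert (Hsub : forall e, (e | 2)%Z \/ Z.gcd e (2 ^ Z.of_nat N) = 1%Z -> divides_all e q ->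
              forall j, (e | w j)%Z).
    { intros e He Heq j. apply Hw. intros x Hx. destruct He as [He|He].
      - eapply Z.divide_trans; [exact He|].
        destruct (HP _ Hx) as [y Hy]. exists y.
        rewrite pow2_S in Hy. apply (Z.mul_reg_l _ _ (2 ^ Z.of_nat N)); lia.
      - apply (Z.gauss _ (2 ^ Z.of_nat N)); auto. }
    destruct (Z.Even_or_Odd d) as [[u Hu]|Hodd].
    + assert (H2q : divides_all 2 q).
      { intros x Hx. apply Z.divide_trans with d; auto. exists u; lia. }
      exists 2%Z; split; [lia|split; auto]. intros j x _ Hdiv.
      replace x with (Z.of_nat 1 * x - w j + w j)%Z by lia.
      apply Z.divide_add_r.
      * apply Z.divide_trans with d; auto. exists u; lia.
      * apply Hsub; auto. left; apply Z.divide_refl.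
    + exists d; split; [auto|split; auto]. intros j x _ Hdiv.
      replace x with (Z.of_nat 1 * x - w j + w j)%Z by lia.
      apply Z.divide_add_r; auto. apply Hsub; auto. right.
      apply odd_coprime_pow2; auto.
Qed.

(** With [w = y] odd, an integer [d] dividing [2 * x - y] must be odd; being a common divisor of [q]
    it divides [2^a * y], hence [y], hence [2 * x] and [x]. So [d' = d] works. *)
Lemma Fset_double v Psi a i0 X : (i0 < n)%nat ->
  Fset v Psi (exact_pow2 a i0) X ->
  Fset v Psi (exact_pow2 a i0)
    (fun i j => 2 * X i j + (if Nat.eqb i i0 then (/2) ^ a else 0)).
Proof.
  intros Hi HX.
  change 2 with (INR 2).
  apply (Fset_affine v Psi _ 2 (fun i j => if Nat.eqb i i0 then (/2) ^ a else 0)); auto.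
  intros q Hq [Hall [y [Hy Hqi]]].
  exists (fun _ => y); split.
  - intros j _. rewrite qX_row, Hqi, mult_IZR, <- pow_IZR by auto.
    rewrite (Rmult_comm (2 ^ a)), Rmult_assoc, <- Rpow_mult_distr.
    replace (2 * / 2) with 1 by lra. rewrite pow1; ring.
  - intros d Hd Hdq. exists d; split; [auto|split; auto]. intros j x _ Hdiv.
    assert (Hodd : Z.Odd d).
    { destruct (Z.Even_or_Odd d) as [[u ->]|]; auto.
      destruct Hdiv as [k Hk], Hy as [l ->]. lia. }
    assert (Hgy : (d | y)%Z).
    { apply (Z.gauss _ (2 ^ Z.of_nat a)).
      - rewrite <- Hqi. destruct (nth_in_or_default i0 q 0%Z) as [Hin| ->]; auto.
        apply Z.divide_0_r.
      - apply odd_coprime_pow2; auto. }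
    apply (Z.gauss _ 2).
    + replace (2 * x)%Z with (Z.of_nat 2 * x - y + y)%Z by lia.
      apply Z.divide_add_r; auto.
    + apply (odd_coprime_pow2 d 1); auto.
Qed.

End LinearForms.

Theorem theorem2 :
  forall (n m : nat), (1 <= n)%nat -> (1 <= m)%nat ->
  forall (Psi : list Z -> R), (forall q, length q = n -> 0 < Psi q) ->
  forall v : variant,
    lebesgue_null n m (F_set v n m Psi) \/
    lebesgue_null n m (fun X => in_cube n m X /\ ~ F_set v n m Psi X).
Proof.
  intros n m Hn Hm Psi HPsi v.
  rewrite !null_ole.
  set (F := Fset n m v Psi (fun _ => True)).
  assert (HF : ole n m F 0 \/ ole n m (fun X => in_cube n m X /\ ~ F X) 0).
  (* One exact class with null complement suffices, because [F] contains it. *)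
  { destruct (classic (exists a i, (i < n)%nat /\
      ole n m (fun X => ~ Fset n m v Psi (exact_pow2 a i) X) 0)) as [[a [i [Hi H]]]|Hno].
    - right. eapply ole_mono; [|apply Rle_refl|exact H].
      intros X [_ HX] HX'; apply HX. eapply Fset_mono; [|exact HX']; auto.
    (* Otherwise the doubling law leaves only nullity for each exact class. *)
    - assert (Hnull : forall a i, (i < n)%nat ->
        ole n m (Fset n m v Psi (exact_pow2 a i)) 0).
      { intros a i Hi.
        destruct (zero_one_doubling n m Hn Hm (Fset n m v Psi (exact_pow2 a i))
          (fun i' _ => if Nat.eqb i' i then (/2) ^ a else 0)) as [H|H]; auto.
        - apply meas_Fset; auto.
        - intros X; apply Fset_double; auto.
        - intros; apply Fset_translate_integer; auto.
        - exfalso; apply Hno; exists a, i; auto. }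
      apply zero_one_translation; auto; [apply meas_Fset; auto|].
      (* The exponent [S N] is one more than integrality of [q t] asks for; the extra factor of 2 is
         spent on coprimality. *)
      intros N. exists (Fset n m v Psi (multiple_pow2 (S N))); split; [|split].
      + intros X; apply Fset_mono; auto.
      + eapply ole_mono; [|apply Rle_refl|].
        (* The exact classes are indexed by one number through the Cantor pairing; the guard keeps
           only the entries [i < n]. *)
        2:{ apply (ole_Union_null n m (fun k X => (snd (of_nat k) < n)%nat /\
              Fset n m v Psi (exact_pow2 (fst (of_nat k)) (snd (of_nat k))) X)).
            intros k. destruct (le_lt_dec n (snd (of_nat k))) as [Hle|Hlt].
            - apply ole_empty; auto. intros X [Hlt _]; lia.
            - eapply ole_mono; [|apply Rle_refl|exact (Hnull (fst (of_nat k)) _ Hlt)]. tauto. }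
        intros X [HX HnX].
        destruct (Fset_pow2_cases n m Hn Hm v Psi X (S N) HX) as [|[a [i [Hi H]]]]; [tauto|].
        exists (to_nat (a, i)); rewrite cancel_of_to; auto.
      + intros; apply Fset_translate_dyadic; auto. }
  destruct HF as [HF|HF]; [left|right]; (eapply ole_mono; [|apply Rle_refl|exact HF]).
  - intros X HX; apply F_set_iff in HX; [apply HX|auto..].
  - intros X [Hc HX]; split; auto. intros H; apply HX, F_set_iff; auto.
Qed.
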